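(* Let $X$ be a Peano continuum without cut points which does not admit an essential map to the circle $S^1$. Suppose a group $G$ acts on $X$ by homeomorphisms and $\mathcal{A}$ is a $G$-invariant collection of connected closed subsets of $X$ such that: (i) $\mathcal{A}$ is null: for every $\epsilon>0$ the set $\{A\in\mathcal{A} : \operatorname{diam}(A)>\epsilon\}$ is finite; (ii) $\mathcal{A}$ is fine: for any $x,y\in X$ there is a finite $\mathcal{B}\subset\mathcal{A}$ such that $\bigcup\mathcal{B}$ separates $x$ from $y$; (iii) for each $A\in\mathcal{A}$, the stabilizer $\mathrm{Stab}(A)=\{g\in G: g(A)=A\}$ acts as a convergence group on $A$. Then $G$ acts as a convergence group on $X$.
   Context: A Peano continuum is a compact, connected, locally connected metric space. A map is essential if it is not homotopic to a constant map. A closed set $S\subset X$ separates $x$ from $y$ (with $x,y\notin S$) if $x$ and $y$ lie in different components of $X\setminus S$. If a group acts by homeomorphisms on a space $Y$, a sequence $(g_i)$ in the group acts as a convergence sequence on $Y$ if there exist points $n,p\in Y$ (possibly equal; called repeller and attractor) such that for every compact $C\subset Y$ with $n\notin C$, $g_i(C)\to p$, meaning that for every neighborhood $U$ of $p$ one has $g_i(C)\subset U$ for all sufficiently large $i$. The group acts as a convergence group on $Y$ if every sequence of distinct elements has a subsequence acting as a convergence sequence on $Y$. *)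

(* Defs.v *)
From HB Require Import structures.
From mathcomp Require Import all_boot all_order all_algebra.
From mathcomp Require Import monoid.
From mathcomp Require Import all_classical all_reals.
From mathcomp Require Import topology normedtype sequences.
Set Implicit Arguments. Unset Strict Implicit. Unset Printing Implicit Defensive.
Import Order.TTheory GRing.Theory Num.Theory.
Import numFieldTopology.Exports numFieldNormedType.Exports.
Local Open Scope classical_set_scope.
Local Open Scope ring_scope.

Section Defs.
Context {R : realType} {X : metricType R}.

Definition cut_point (x : X) : Prop := ~ connected (~` [set x]).

Definition locally_connected_space : Prop :=
  forall (x : X) (U : set X), nbhs x U ->
    exists V : set X, [/\ open V, connected V, V x & V `<=` U].

Definition peano_continuum : Prop :=
  [/\ compact [set: X], connected [set: X], locally_connected_space
    & [set: X] !=set0].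

Definition on_circle (z : R * R) : Prop := z.1 ^+ 2 + z.2 ^+ 2 = 1.

Definition circle_map (f : X -> R * R) : Prop :=
  continuous f /\ forall x, on_circle (f x).

Definition nullhomotopic_circle_map (f : X -> R * R) : Prop :=
  exists (H : X * R -> R * R) (c : R * R),
    [/\ {within [set: X] `*` `[0, 1]%classic, continuous H},
        (forall x t, `[0, 1]%classic t -> on_circle (H (x, t))),
        (forall x, H (x, 0) = f x)
      & (forall x, H (x, 1) = c)].

Definition essential_circle_map (f : X -> R * R) : Prop :=
  circle_map f /\ ~ nullhomotopic_circle_map f.

Definition diam (A : set X) : R :=
  sup [set mdist x y | x in A & y in A].

Definition separates (S : set X) (x y : X) : Prop :=
  [/\ ~ S x, ~ S y & ~ connected_component (~` S) x y].

End Defs.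

Section Action.
Context {R : realType} {X : metricType R} {G : groupType}.

Definition action_by_homeos (act : G -> X -> X) : Prop :=
  [/\ forall g, continuous (act g),
      forall x, act 1%g x = x
    & forall g h x, act (g * h)%g x = act g (act h x)].

Definition convergence_sequence_on (act : G -> X -> X) (Y : set X)
    (g : nat -> G) : Prop :=
  exists n p : X, [/\ Y n, Y p &
    forall C : set X, C `<=` Y -> compact C -> ~ C n ->
      forall U : set X, nbhs p U ->
        \forall i \near \oo, act (g i) @` C `<=` U].

Definition convergence_group_on (act : G -> X -> X) (H : set G) (Y : set X)
  : Prop :=
  forall g : nat -> G, injective g -> (forall i, H (g i)) ->
    exists phi : nat -> nat, {homo phi : m n / (m < n)%N} /\
      convergence_sequence_on act Y (g \o phi).

Definition stabilizer (act : G -> X -> X) (A : set X) : set G :=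
  [set g | act g @` A = A].

End Action.

(* Main.v *)
Require Import Defs.
From HB Require Import structures.
From mathcomp Require Import all_boot all_order all_algebra.
From mathcomp Require Import monoid.
From mathcomp Require Import all_classical all_reals.
From mathcomp Require Import topology normedtype sequences.
From mathcomp Require Import interval_inference trigo.
From mathcomp Require Import ring lra.
Set Implicit Arguments. Unset Strict Implicit. Unset Printing Implicit Defensive.
Import Order.TTheory GRing.Theory Num.Theory.
Import numFieldTopology.Exports numFieldNormedType.Exports.
Local Open Scope classical_set_scope.
Local Open Scope ring_scope.

(** Fix a sequence of distinct elements g_i and a nonprincipal ultrafilter on
    the indices, and call a point regular if some neighbourhood of it is
    collapsed to a point by the g_i along the ultrafilter. It suffices to show
    that there is at most one singular point n: the limits of the regular points
    are then locally constant on the connected set X \ {n}.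

    A Peano continuum without essential circle maps is unicoherent, so points
    separated by a finite union S of members of cA are separated by a continuum
    T contained in S. If the g_i collapse T, then, as X has no cut points, one
    of the two sides collapses too; hence T cannot separate two singular points.
    By nullness and (iii), each A in cA either collapses or is eventually mapped
    to a fixed set A', collapsing to p_A away from a repeller n_A, which is
    singular. Hence two singular points force some n_A to exist. Let t be the
    limit of g_i^-1 p_A. Every C with p_A in C' contains t, so by nullness the
    repellers of such C accumulate only at t. A small separator T between n_A
    and another singular point meets A, hence has p_A in its limit; if T
    contains no repeller of a set C with p_A in C', then the whole of T collapses to
    p_A, a contradiction. This settles t <> n_A; the same argument shows that n_A
    is the only singular point of A in general, and then, if t = n_A, all these
    repellers coincide with n_A and the argument applies again. *)

(** * Connectedness and separators *)

Section Topology.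
Context {T : topologicalType}.
Implicit Types A B C K Q S U V W Z : set T.

Lemma connected_sub_open A B C : connected C -> open A -> open B ->
  C `<=` A `|` B -> C `&` A `&` B = set0 -> C `&` A !=set0 -> C `<=` A.
Proof.
move=> cC oA oB CAB CAB0 CA0; suff <- : C `&` A = C by move=> x [].
apply: cC => //; first by exists A.
exists (~` B); first exact: open_closedC.
apply/seteqP; split=> x [Cx Hx]; split=> //.
  by move=> Bx; have : (C `&` A `&` B) x by []; rewrite CAB0.
by have [] := CAB x Cx.
Qed.

Lemma connected_meet_boundary V Z : open V -> connected Z ->
  Z `&` V !=set0 -> ~ (Z `<=` V) -> Z `&` (closure V `\` V) !=set0.
Proof.
move=> oV cZ ZV0 ZV; apply: contrapT => ZdV; apply: ZV.
apply: (@connected_sub_open V (~` closure V)) => //.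
- exact/closed_openC/closed_closure.
- move=> x Zx; have [|] := pselect (closure V x); last by right.
  by move=> cVx; left; apply: contrapT => Vx; apply: ZdV; exists x.
- by rewrite -subset0 => x [[_ Vx]]; apply; apply: subset_closure.
Qed.

(* The subsets of [K] with complement satisfying [P] would otherwise form a
   proper filter without cluster point in [K]. *)
Lemma compact_local_property (P : set T -> Prop) K : compact K ->
  P set0 -> (forall A B, A `<=` B -> P B -> P A) ->
  (forall A B, P A -> P B -> P (A `|` B)) ->
  (forall x, K x -> exists2 U, nbhs x U & P U) -> P K.
Proof.
move=> cK P0 PS PU Ploc; apply: contrapT => PK.
pose F := [set A | P (K `\` A)].
have FF : ProperFilter F.
  split; first by rewrite /F/= setD0.
  split; rewrite /F/=.
  - by rewrite setDT.
  - by move=> A B PA PB /=; rewrite setDIr; apply: PU.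
  - by move=> A B AB; apply: PS; apply: setDS.
have [|x [Kx clx]] := cK F FF; first by rewrite /F/= setDv.
have [U nU PU'] := Ploc x Kx.
have [||y []//] := clx (~` U) U => //.
by apply: PS PU' => y [_] /contrapT.
Qed.

Lemma component_open (lc : forall (x : T) U, nbhs x U ->
    exists V, [/\ open V, connected V, V x & V `<=` U]) A x :
  open A -> open (connected_component A x).
Proof.
move=> oA; rewrite openE => y Cy.
have Ay := connected_component_sub Cy.
have [|V [oV cV Vy VA]] := lc y A; first by apply: open_nbhs_nbhs.
apply: (@filterS _ _ _ V); last by apply: open_nbhs_nbhs.
move=> z Vz; apply: connected_component_trans Cy _.
by exists V.
Qed.

End Topology.

Section Continuum.
Context {R : realType} {X : metricType R}.
Hypothesis lc : locally_connected_space (X := X).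
Implicit Types (x y q w : X) (A B C K Q S U V W Z : set X).

Lemma nbhs_closed_sub x U : nbhs x U ->
  exists V, [/\ open V, V x & closure V `<=` U].
Proof.
move=> /(@uniform_regular X x)[V + VU]; rewrite nbhsE => -[W [oW Wx] WV].
exists W; split => //; apply: subset_trans VU; exact: closureS.
Qed.

Lemma nbhs_connected_closed_sub x U : nbhs x U ->
  exists V, [/\ open V, connected V, V x & closure V `<=` U].
Proof.
move=> /nbhs_closed_sub[V [oV Vx VU]].
have [|W [oW cW Wx WV]] := @lc x V; first exact: open_nbhs_nbhs.
exists W; split => //; apply: subset_trans VU; exact: closureS.
Qed.

Lemma closed_set1 x : closed [set x].
Proof.
apply: accessible_closed_set1; apply: hausdorff_accessible.
exact: metric_hausdorff.
Qed.

Lemma nbhs_neq x y : x <> y -> nbhs x (~` [set y]).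
Proof.
move=> xy; apply: open_nbhs_nbhs; split; first exact/closed_openC/closed_set1.
exact: xy.
Qed.

(** By local connectedness, the points joined to a base point [a] by a connected set whose closure
    avoids [q] form a clopen part of the complement of [q], hence all of it. Compactness of [K] then
    leaves a finite union of such sets. *)
Lemma connected_hull q K : connected (~` [set q]) -> compact K -> ~ K q ->
  exists Q, [/\ connected Q, K `<=` Q & ~ closure Q q].
Proof.
move=> cq cK Kq; have [[a qa]|/nonemptyPn noa] := pselect (~` [set q] !=set0);
    last first.
  exists set0; split; [exact: connected0| |by rewrite closure0].
  move=> x Kx; have : (~` [set q]) x by move=> /= xq; rewrite -xq in Kq.
  by rewrite noa.
pose good y := exists Q, [/\ connected Q, Q a, Q y & ~ closure Q q].
have step y z V : good y -> connected V -> V y -> V z -> ~ closure V q -> good z.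
  move=> [Q [cQ Qa Qy Qq]] cV Vy Vz Vq; exists (Q `|` V); split => //.
  - by apply: connectedU => //; exists y.
  - by left.
  - by right.
  - by rewrite closureU => -[].
have nbV y : y <> q -> exists V, [/\ open V, connected V, V y & ~ closure V q].
  move=> /nbhs_neq /nbhs_connected_closed_sub[V [oV cV Vy VU]].
  by exists V; split => // /VU; apply.
have oG : open [set y | good y].
  rewrite openE => y gy.
  have yq : y <> q.
    by move=> yq; case: gy => Q [_ _ + +]; rewrite yq => /subset_closure.
  have [V [oV cV Vy Vq]] := nbV y yq.
  apply: (@filterS _ _ _ V); last exact: open_nbhs_nbhs.
  by move=> z Vz; exact: step gy cV Vy Vz Vq.
have oB : open [set y | y <> q /\ ~ good y].
  rewrite openE => y [yq gy].
  have [V [oV cV Vy Vq]] := nbV y yq.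
  apply: (@filterS _ _ _ V); last exact: open_nbhs_nbhs.
  move=> z Vz; split; first by move=> zq; apply: Vq; rewrite -zq; exact: subset_closure.
  by move=> gz; apply: gy; exact: step gz cV Vz Vy Vq.
have allgood : ~` [set q] `<=` [set y | good y].
  apply: (connected_sub_open cq oG oB).
  - by move=> y yq; have [|] := pselect (good y); [left|right].
  - by rewrite -subset0 => y [[_ gy] []].
  - exists a; split=> //; have [V [oV cV Va Vq]] := nbV a qa.
    by exists V.
suff [Q [cQ Qa KQ Qq]] : exists Q, [/\ connected Q, Q a, K `<=` Q & ~ closure Q q].
  by exists Q.
apply: (compact_local_property cK (P := fun K => exists Q,
    [/\ connected Q, Q a, K `<=` Q & ~ closure Q q])).
- have [Q [cQ Qa _ Qq]] := allgood a qa; exists Q; split => //.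
- by move=> A B AB [Q [cQ Qa BQ Qq]]; exists Q; split => //; apply: subset_trans BQ.
- move=> A B [Q1 [c1 a1 A1 q1]] [Q2 [c2 a2 A2 q2]]; exists (Q1 `|` Q2); split.
  + by apply: connectedU => //; exists a.
  + by left.
  + by apply: setUSS.
  + by rewrite closureU => -[].
- move=> y Ky; have yq : y <> q by move=> yq; rewrite yq in Ky.
  have [V [oV cV Vy Vq]] := nbV y yq.
  have [Q [cQ Qa Qy Qq]] := allgood y yq.
  exists V; first exact: open_nbhs_nbhs.
  exists (Q `|` V); split => //; last by rewrite closureU => -[].
  + by apply: connectedU => //; exists y.
  + by left.
Qed.

(** Separation tested on connected sets, so that it passes to subsets of [Q] and applies directly to
    a member of [cA] joining [w] to [Q]. *)
Definition meets_between T Q w :=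
  forall Z, connected Z -> Z w -> Z `&` Q !=set0 -> Z `&` T !=set0.

Definition unicoherent := forall P Q, closed P -> closed Q -> connected P ->
  connected Q -> P `|` Q = [set: X] -> connected (P `&` Q).

Lemma component_closure_sub A x : open A ->
  closure (connected_component A x) `&` A `<=` connected_component A x.
Proof.
move=> oA y [cy Ay].
have oy := @component_open X lc A y oA.
have [|z [Cz Cyz]] := cy (connected_component A y).
  apply: open_nbhs_nbhs; split=> //; exact: connected_component_refl.
apply: connected_component_trans Cz _; exact: connected_component_sym.
Qed.

(* [T] is the boundary of the component of the complement of
   [closure (connected_component (~` S) w)] that contains [Q]. *)
Lemma boundary_separator S Q w : connected [set: X] -> unicoherent ->
  closed S -> ~ S w -> connected Q -> Q !=set0 ->
  closure (connected_component (~` S) w) `&` Q = set0 ->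
  exists T, [/\ closed T /\ connected T, T `<=` S,
    T `<=` closure (connected_component (~` S) w), ~ T w /\ T `&` Q = set0 &
    meets_between T Q w].
Proof.
move=> cX uX clS Sw cQ [y Qy] UQ0.
set U := connected_component (~` S) w.
have Uw : U w by exact: connected_component_refl.
have oS : open (~` S) by exact: closed_openC.
have oU : open U by exact: component_open.
have cU : connected U by exact: component_connected.
pose O := ~` closure U.
have oO : open O by exact/closed_openC/closed_closure.
pose V := connected_component O y.
have oV : open V by exact: component_open.
have QO : Q `<=` O by move=> z Qz Uz; have : (closure U `&` Q) z by []; rewrite UQ0.
have QV : Q `<=` V by move=> z Qz; exists Q.
have VO : V `<=` O by exact: connected_component_sub.
have Vw : ~ V w by move/VO; apply; apply: subset_closure.
exists (closure V `&` ~` V); split.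
- split; first by apply: closedI; [exact: closed_closure|exact: open_closedC].
  (* The boundary of [V] is the intersection of [closure V] and the complement of [V], which cover
     [X]; connectedness of the second is the point at issue. *)
  apply: uX.
  + exact: closed_closure.
  + exact: open_closedC.
  + exact/connected_closure/component_connected.
  (* The closure of any component of [O] meets [closure U], since otherwise the component would be
     clopen. So the complement of [V] is a union of connected sets through [w]. *)
  + pose D z := closure U `|` closure (connected_component O z).
    have -> : ~` V = \bigcup_(z in [set z | ~ V z]) D z.
      apply/seteqP; split=> z.
        move=> Vz; exists z => //; rewrite /D.
        have [?|Oz] := pselect (closure U z); first by left.
        by right; apply: subset_closure; exact: connected_component_refl.
      move=> [t Vt [Uz /VO//|tz Vz]].
      have [s [ts Vs]] := tz V (open_nbhs_nbhs (conj oV Vz)).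
      apply: Vt; apply: connected_component_trans Vs _.
      exact: connected_component_sym.
    apply: bigcup_connected.
      by exists w => t _; left; apply: subset_closure.
    move=> t Vt.
    have [Ot|Ot] := pselect (O t); last first.
      rewrite /D connected_component_out// closure0 setU0.
      exact: connected_closure.
    apply: connectedU; last 2 first.
      exact: connected_closure.
    exact/connected_closure/component_connected.
    apply: contrapT => D0.
    have clOt : closed (connected_component O t).
      move=> z ctz; apply: component_closure_sub => //; split=> // Uz.
      by apply: D0; exists z.
    have : [set: X] `<=` connected_component O t.
      have oc := @component_open X lc O t oO.
      apply: (connected_sub_open cX oc (closed_openC clOt)).
      * by move=> z _; have [|] := pselect (connected_component O t z); [left|right].
      * by rewrite -subset0 => z [[]].
      * by exists t; split=> //; exact: connected_component_refl.
    move=> /(_ w I) /(@connected_component_sub _ O t); apply.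
    exact: subset_closure.
  + apply/seteqP; split=> // z _.
    have [Vz|] := pselect (V z); last by right.
    by left; apply: subset_closure.
(* A boundary point of [V] outside [S] would lie either in the open set [U], which misses [V], or in
   [O] and hence in [V] itself. *)
- move=> z [cVz Vz]; apply: contrapT => Sz.
  have [Uz|Uz] := pselect (closure U z).
    have {}Uz : U z by exact: component_closure_sub.
    have [s [Vs Us]] := cVz U (open_nbhs_nbhs (conj oU Uz)).
    by apply: (VO s) => //; exact: subset_closure.
  by apply: Vz; apply: component_closure_sub.
- move=> z [cVz Vz]; apply: contrapT => Uz.
  by apply: Vz; apply: component_closure_sub.
- split.
    move=> [cVw _].
    have [s [Vs Us]] := cVw U (open_nbhs_nbhs (conj oU Uw)).
    by apply: (VO s) => //; exact: subset_closure.
  by rewrite -subset0 => z [[_ Vz] /QV].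
- move=> Z cZ Zw [z [Zz Qz]]; apply: connected_meet_boundary => //.
    by exists z; split => //; exact: QV.
  by move=> /(_ w Zw).
Qed.

(** Fineness handles one point [y] of [K], together with its open component. Compactness then leaves
    finitely many families, and passing to their union only shrinks the component of [w]. *)
Lemma neighbourhood_basis (cA : set (set X)) w K :
  (forall A, cA A -> closed A) ->
  (forall x y, x <> y ->
     exists B : set (set X), [/\ finite_set B, B `<=` cA &
       separates (\bigcup_(A in B) A) x y]) ->
  compact K -> ~ K w ->
  exists B : set (set X), [/\ finite_set B, B `<=` cA, ~ (\bigcup_(A in B) A) w &
    closure (connected_component (~` \bigcup_(A in B) A) w) `&` K = set0].
Proof.
move=> clA fine cK Kw.
apply: (compact_local_property (K := K) (P := fun K => exists B : set (set X),
   [/\ finite_set B, B `<=` cA, ~ (\bigcup_(A in B) A) w &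
    closure (connected_component (~` \bigcup_(A in B) A) w) `&` K = set0])) => //.
- exists set0; split; [exact: finite_set0|by []|by rewrite bigcup_set0|].
  by rewrite setI0.
- move=> A B AB [D [fD DA Dw D0]]; exists D; split => //.
  by rewrite -subset0 => z [z1 /AB z2]; rewrite -D0.
- move=> A B [D1 [f1 A1 w1 d1]] [D2 [f2 A2 w2 d2]].
  exists (D1 `|` D2); split.
  + by rewrite finite_setU.
  + by rewrite subUset.
  + by rewrite bigcup_setU => -[].
  + rewrite -subset0 => z [+ ABz].
    have sub (D : set (set X)) : D `<=` D1 `|` D2 ->
        connected_component (~` \bigcup_(A0 in D1 `|` D2) A0) w `<=`
        connected_component (~` \bigcup_(A0 in D) A0) w.
      move=> DD t [C [Cw CS cC] Ct]; exists C => //; split=> // s /CS + Ds.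
      by apply; apply: bigcup_subset Ds.
    case: ABz => [Az|Bz] cz.
      by rewrite -d1; split => //; apply: closureS cz; apply: sub => ?; left.
    by rewrite -d2; split => //; apply: closureS cz; apply: sub => ?; right.
- move=> y Ky; have wy : w <> y by move=> wy; rewrite wy in Kw.
  have [B [fB BA [Bw By sep]]] := fine w y wy.
  have oB : open (~` \bigcup_(A in B) A).
    by apply: closed_openC; apply: closed_bigcup => // A /BA /clA.
  exists (connected_component (~` \bigcup_(A in B) A) y).
    apply: open_nbhs_nbhs; split; first exact: component_open.
    exact: connected_component_refl.
  exists B; split => //; rewrite -subset0 => z [z1 z2].
  apply: sep.
  have z3 : connected_component (~` \bigcup_(A in B) A) w z.
    apply: component_closure_sub => //; split=> //.
    exact: (connected_component_sub z2).
  by apply: connected_component_trans z3 _; exact: connected_component_sym.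
Qed.

End Continuum.

(** * Circle-valued maps and unicoherence *)

Section CircleMaps.
Context {R : realType}.
Implicit Types (p q : R * R) (a b : R).

(** On the circle, [dotp] and [crossp] are the cosine and the sine of the angle from [p] to [q]. *)
Definition dotp p q : R := p.1 * q.1 + p.2 * q.2.
Definition crossp p q : R := p.1 * q.2 - p.2 * q.1.

Lemma cvg_fst_comp {T : Type} (F : set_system T) {FF : Filter F}
  (f : T -> R * R) p : f @ F --> p -> (f x).1 @[x --> F] --> p.1.
Proof. by move=> fp; apply: cvg_comp fp _; exact: cvg_fst. Qed.

Lemma cvg_snd_comp {T : Type} (F : set_system T) {FF : Filter F}
  (f : T -> R * R) p : f @ F --> p -> (f x).2 @[x --> F] --> p.2.
Proof. by move=> fp; apply: cvg_comp fp _; exact: cvg_snd. Qed.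

Lemma cvg_dotp {T : Type} (F : set_system T) {FF : Filter F}
    (f g : T -> R * R) p q : f @ F --> p -> g @ F --> q ->
  dotp (f x) (g x) @[x --> F] --> dotp p q.
Proof.
move=> fp gq; apply: cvgD; apply: cvgM; first [exact: cvg_fst_comp|exact: cvg_snd_comp].
Qed.

Lemma cvg_crossp {T : Type} (F : set_system T) {FF : Filter F}
    (f g : T -> R * R) p q : f @ F --> p -> g @ F --> q ->
  crossp (f x) (g x) @[x --> F] --> crossp p q.
Proof.
move=> fp gq; apply: cvgB; apply: cvgM; first [exact: cvg_fst_comp|exact: cvg_snd_comp].
Qed.

Lemma dotp2D_crossp2 p q : on_circle p -> on_circle q ->
  dotp p q ^+ 2 + crossp p q ^+ 2 = 1.
Proof.
rewrite /on_circle /dotp /crossp => hp hq.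
transitivity ((p.1 ^+ 2 + p.2 ^+ 2) * (q.1 ^+ 2 + q.2 ^+ 2)); first by ring.
by rewrite hp hq mulr1.
Qed.

Definition polar a : R * R := (cos a, sin a).

Lemma on_circle_polar a : on_circle (polar a).
Proof. exact: cos2Dsin2. Qed.

Lemma on_circleP p : on_circle p -> exists a, p = polar a.
Proof.
case: p => x y; rewrite /on_circle /= => xy1.
have x1 : -1 <= x <= 1 by nra.
have xI : x \in `[(-1), 1] by rewrite in_itv.
have y2 : 1 - x ^+ 2 = y ^+ 2 by lra.
have [y0|y0] := leP 0 y.
  by exists (acos x); rewrite /polar acosK// sin_acos// y2 sqrtr_sqr ger0_norm.
exists (- acos x); rewrite /polar cosN sinN acosK// sin_acos// y2 sqrtr_sqr.
by rewrite ltr0_norm// opprK.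
Qed.

(** A positive cosine puts the angle between the two points strictly within a right angle of 0,
    where [asin] recovers it. *)
Lemma polarD_asin p a : on_circle p -> 0 < dotp (polar a) p ->
  p = polar (a + asin (crossp (polar a) p)).
Proof.
move=> hp d0; have ha := on_circle_polar a.
have dc := dotp2D_crossp2 ha hp.
set c := crossp _ _ in dc *; set d := dotp _ _ in d0 dc.
have c1 : -1 <= c <= 1 by nra.
have cI : c \in `[(-1), 1] by rewrite in_itv.
have cd : cos (asin c) = d.
  by rewrite cos_asin// -dc addrK sqrtr_sqr gtr0_norm.
rewrite /polar cosD sinD cd asinK// /c /d; clear c d dc d0 c1 cI cd.
case: p hp => x y; rewrite /on_circle /dotp /crossp /polar /= in ha * => hp.
by congr pair; [rewrite -[LHS]mul1r|rewrite -[LHS]mul1r]; rewrite -ha; ring.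
Qed.

(** * Continuous logarithms and their invariance under homotopy *)

Section Lift.
Context {X : topologicalType}.
Implicit Types (f g : X -> R * R).

Definition liftable f := exists2 theta : X -> R,
  continuous theta & forall x, f x = polar (theta x).

Lemma liftable_close f g : continuous f -> continuous g ->
  (forall x, on_circle (g x)) -> (forall x, 0 < dotp (f x) (g x)) ->
  liftable f -> liftable g.
Proof.
move=> cf cg og fg [theta ct ft].
exists (fun x => theta x + asin (crossp (f x) (g x))).
  move=> x; apply: cvgD; first exact: ct.
  apply: (@cvg_comp _ _ _ (fun x => crossp (f x) (g x)) (@asin R) _
     (nbhs (crossp (f x) (g x)))).
    by apply: cvg_crossp; [exact: cf|exact: cg].
  apply: continuous_asin.
  have fo : on_circle (f x) by rewrite ft; exact: on_circle_polar.
  by have := dotp2D_crossp2 fo (og x); have := fg x; nra.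
by move=> x; rewrite ft -polarD_asin// -ft.
Qed.

Variable H : X * R -> R * R.
Hypothesis cX : compact [set: X].
Hypothesis cH : {within [set: X] `*` `[0, 1]%classic, continuous H}.
Hypothesis oH : forall x (t : R), `[0, 1]%classic t -> on_circle (H (x, t)).

Lemma homotopy_slice_continuous (t : R) : `[0, 1]%classic t ->
  continuous (fun x => H (x, t)).
Proof.
move=> t01 x U nU.
have /subspace_continuousP := cH => /(_ (x, t)) /(_ (conj I t01)) /(_ U nU).
move=> [[V W] /= [nV nW] VW]; rewrite nbhs_simpl /=.
apply: filterS nV => z Vz.
have := VW (z, t) (conj Vz (nbhs_singleton nW)); exact.
Qed.

(** A tube argument: compactness of [X] makes the pointwise closeness of neighbouring slices
    uniform. *)
Lemma homotopy_near_positive (t : R) : `[0, 1]%classic t ->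
  \forall s \near t, `[0, 1]%classic s ->
    forall x, 0 < dotp (H (x, t)) (H (x, s)).
Proof.
move=> t01.
have := (compact_near_coveringP [set: X]).1 cX R (nbhs t)
  (fun (s : R) x => `[0, 1]%classic s -> 0 < dotp (H (x, t)) (H (x, s))) _.
have -> : (\forall s \near t, `[0, 1]%classic s ->
    forall x, 0 < dotp (H (x, t)) (H (x, s))) =
  (\forall s \near t, [set: X] `<=`
    (fun x => `[0, 1]%classic s -> 0 < dotp (H (x, t)) (H (x, s)))).
  congr (nbhs t _); apply/seteqP; split=> s h.
    by move=> x _ s01; exact: h.
  by move=> s01 x; exact: h.
apply => x _.
pose A : set (X * R) := [set: X] `*` `[0, 1]%classic.
have hH : H @ within A (nbhs (x, t)) --> H (x, t).
  by apply/(subspace_continuousP A H).1.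
have hHt : (fun z : X * R => H (z.1, t)) @ within A (nbhs (x, t)) --> H (x, t).
  apply: cvg_within_filter.
  apply: (@cvg_comp _ _ _ fst (fun y => H (y, t)) _ (nbhs x)); first exact: cvg_fst.
  exact: homotopy_slice_continuous.
have pos : 0 < dotp (H (x, t)) (H (x, t)).
  by have := oH x t01; rewrite /on_circle /dotp !expr2 => ->.
have : \forall z \near within A (nbhs (x, t)), 0 < dotp (H (z.1, t)) (H z).
  by apply: (@cvgr_gt _ _ _ _ _ _ (cvg_dotp hHt hH)); exact: pos.
move=> [[V W] /= [nV nW] VW]; exists (V, W) => //= -[y s] /= [Vy Ws] s01.
by apply: (VW (y, s)).
Qed.

(** The times with a liftable slice form a clopen part of the unit interval, because
    [liftable_close] works in both directions between neighbouring slices. *)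
Lemma liftable_homotopic : liftable (fun x => H (x, 1)) ->
  liftable (fun x => H (x, 0)).
Proof.
move=> L1; pose L (t : R) := liftable (fun x => H (x, t)).
pose I01 : set R := `[0, 1]%classic.
have I0 : I01 0 by rewrite /I01/= in_itv/= lexx ler01.
have I1 : I01 1 by rewrite /I01/= in_itv/= lexx ler01.
have dotC p q : dotp p q = dotp q p by rewrite /dotp ![_ * q.1]mulrC ![_ * q.2]mulrC.
have nL t : I01 t -> L t -> nbhs t (fun s => I01 s -> L s).
  move=> It Lt; apply: filterS (homotopy_near_positive It) => s h Is.
  apply: liftable_close Lt; [exact: homotopy_slice_continuous..| |exact: h].
  by move=> x; exact: oH.
have nN t : I01 t -> ~ L t -> nbhs t (fun s => I01 s -> ~ L s).
  move=> It Lt; apply: filterS (homotopy_near_positive It) => s h Is Ls.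
  apply: Lt; apply: liftable_close Ls; [exact: homotopy_slice_continuous..| |].
  - by move=> x; exact: oH.
  - by move=> x; rewrite dotC; exact: h.
suff : I01 `<=` interior (fun s => I01 s -> L s).
  by move=> /(_ 0 I0) /interior_subset; apply.
apply: (@connected_sub_open _ _ (interior (fun s => I01 s -> ~ L s))).
- exact: segment_connected.
- exact: open_interior.
- exact: open_interior.
- by move=> t It; have [/(nL t It)|/(nN t It)] := pselect (L t); [left|right].
- rewrite -subset0 => t [[It /interior_subset h1] /interior_subset h2].
  exact: h2 (h1 It).
- by exists 1; split => //; exact: nL.
Qed.

End Lift.

Lemma polar_eq0_connected_const {X : topologicalType} (C : set X) (f : X -> R) :
  connected C -> {within C, continuous f} -> (forall x, C x -> polar (f x) = polar 0) ->
  forall x y, C x -> C y -> f x = f y.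
Proof.
move=> cC cf f1.
suff H x y : C x -> C y -> ~ f x < f y.
  by move=> x y Cx Cy; have [/H|/H|//] := ltgtP (f x) (f y); tauto.
move=> Cx Cy xy.
have /connected_intervalP iI := connected_continuous_connected cC cf.
(* The bound by [f y - f x] makes [f x + d] an intermediate value; the bound by [pi] keeps [d] where
   [cos] is strictly decreasing, so [cos d] is not 1. *)
pose d := Num.min (f y - f x) pi.
have d0 : 0 < d by rewrite lt_min subr_gt0 xy pi_gt0.
have dpi : d <= pi by rewrite ge_min lexx orbT.
have dxy : d <= f y - f x by rewrite ge_min lexx.
have [z Cz zd] : (f @` C) (f x + d).
  apply: (iI (f x) (f y)); [by exists x|by exists y|].
  by rewrite lerDl ltW//= -lerBrDl.
have /(congr1 fst)/= := f1 z Cz; rewrite zd cosD.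
have [-> ->] : cos (f x) = 1 /\ sin (f x) = 0.
  by have [-> ->] := f1 x Cx; rewrite cos0 sin0.
rewrite mul1r mul0r subr0 cos0 => cd1.
have : cos d < cos 0.
  by rewrite ltr_cos// in_itv/= ?lexx ?(ltW d0) ?dpi ?pi_ge0.
by rewrite cd1 cos0 ltxx.
Qed.

End CircleMaps.

Section Unicoherence.
Context {R : realType} {X : metricType R}.

Lemma nullhomotopic_liftable (f : X -> R * R) : compact [set: X] ->
  nullhomotopic_circle_map f -> liftable f.
Proof.
move=> cX [H [c [cH oH H0 H1]]].
(* The end value [c] is known to lie on the circle only through a point of [X], so the empty space
   is treated apart. *)
have [x0|/nonemptyPn noX] := pselect ([set: X] !=set0); last first.
  have noX' (x : X) : False by have : [set: X] x by []; rewrite noX.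
  by exists (fun=> 0) => x; case: (noX' x).
have [] := liftable_homotopic cX cH oH.
  have [x _] := x0.
  have [|a ca] := @on_circleP R c.
    by rewrite -(H1 x); apply: oH; rewrite /= in_itv/= lexx ler01.
  by exists (fun=> a) => [y|y]; [exact: cvg_cst|rewrite H1].
by move=> theta ct h; exists theta => // x; rewrite -H0 h.
Qed.

(* If the closed sets [E] and [F] decompose the intersection of the continua
   [P] and [Q] and [u] is [0] on [E] and [1] on [F], then the map that is
   exp(i pi u) on [P] and exp(- i pi u) on [Q] has no continuous logarithm. *)
Lemma no_essential_map_unicoherent : compact [set: X] ->
  ~ (exists f : X -> R * R, essential_circle_map f) -> unicoherent (X := X).
Proof.
move=> cX noess P Q clP clQ cP cQ PQ; apply: contrapT.
move=> /connectedPn[D [D0 DE [sep1 sep2]]].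
pose E := D false; pose F := D true.
have clPQ : closed (P `&` Q) by exact: closedI.
have EPQ : E `<=` P `&` Q by rewrite DE => x; left.
have FPQ : F `<=` P `&` Q by rewrite DE => x; right.
have clE : closed E.
  move=> x cx; have : (P `&` Q) x by apply: clPQ; exact: closureS cx.
  rewrite DE => -[//|Fx]; have : (closure (D false) `&` D true) x by [].
  by rewrite sep1.
have clF : closed F.
  move=> x cx; have : (P `&` Q) x by apply: clPQ; exact: closureS cx.
  rewrite DE => -[Ex|//]; have : (D false `&` closure (D true)) x by [].
  by rewrite sep2.
have EF0 : E `&` F = set0.
  by rewrite -subset0 => x [/subset_closure Ex Fx]; rewrite -sep1.
have /(@uniform_separatorP X R)[u [cu _ u0 u1]] :=
  (@normal_separatorP R X).1 (@pseudometric_normal R X) E F clE clF EF0.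
have uE x : E x -> u x = 0 by move=> Ex; apply: u0; exists x.
have uF x : F x -> u x = 1 by move=> Fx; apply: u1; exists x.
(* The two formulas agree on the intersection of [P] and [Q], where [u] is 0 or 1 and the sine
   vanishes. *)
pose s x := if `[< P x >] then sin (pi * u x) else - sin (pi * u x).
have sP x : P x -> s x = sin (pi * u x) by rewrite /s; case: asboolP.
have sQ x : Q x -> s x = - sin (pi * u x).
  move=> Qx; rewrite /s; case: asboolP => // Px.
  have : (P `&` Q) x by []; rewrite DE => -[/uE ->|/uF ->].
    by rewrite mulr0 sin0 oppr0.
  by rewrite mulr1 sinpi oppr0.
have cpu : continuous (fun x => pi * u x).
  by move=> x; apply: cvgM; [exact: cvg_cst|exact: cu].
have csin : continuous (fun x => sin (pi * u x)).
  by move=> x; apply: continuous_comp; [exact: cpu|exact: continuous_sin].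
have csinN : continuous (fun x => - sin (pi * u x)).
  by move=> x; apply: cvgN; exact: csin.
have cs : continuous s.
  apply/continuous_subspace_setT; rewrite -PQ.
  apply: withinU_continuous => //.
    apply: (@subspace_eq_continuous _ P _ (fun x => sin (pi * u x))).
      by move=> x /set_mem Px; symmetry; exact: sP.
    exact: continuous_subspaceT.
  apply: (@subspace_eq_continuous _ Q _ (fun x => - sin (pi * u x))).
    by move=> x /set_mem Qx; symmetry; exact: sQ.
  exact: continuous_subspaceT.
pose f x : R * R := (cos (pi * u x), s x).
have cf : continuous f.
  move=> x; apply: (@cvg_pair _ _ _ (nbhs x) (nbhs _) (nbhs _)); last exact: cs.
  by apply: continuous_comp; [exact: cpu|exact: continuous_cos].
have of_ x : on_circle (f x).
  rewrite /on_circle /= /s; case: ifP => _; first exact: cos2Dsin2.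
  by rewrite sqrrN; exact: cos2Dsin2.
have [theta ct ft] : liftable f.
  apply: nullhomotopic_liftable => //; apply: contrapT => nf.
  by apply: noess; exists f.
have [e Ee] := D0 false; have [h Fh] := D0 true.
have [Pe Qe] := EPQ e Ee; have [Ph Qh] := FPQ h Fh.
(* On [P] the function [theta - pi * u] takes values in the multiples of 2 pi, so it is constant; on
   [Q] the same holds for [theta + pi * u]. Comparing [e] with [h] gives incompatible values of
   [theta e - theta h]. *)
have hP : theta e - pi * u e = theta h - pi * u h.
  apply: (polar_eq0_connected_const (f := fun x => theta x - pi * u x) cP) => //.
    apply: continuous_subspaceT => x; apply: cvgB; [exact: ct|exact: cpu].
  move=> x Px; have [ct1 st1] := ft x.
  rewrite /polar cosB sinB -ct1 -st1 sP// -!expr2 cos2Dsin2 cos0 sin0.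
  by congr pair; ring.
have hQ : theta e + pi * u e = theta h + pi * u h.
  apply: (polar_eq0_connected_const (f := fun x => theta x + pi * u x) cQ) => //.
    apply: continuous_subspaceT => x; apply: cvgD; [exact: ct|exact: cpu].
  move=> x Qx; have [ct1 st1] := ft x.
  rewrite /polar cosD sinD -ct1 -st1 sQ// mulNr opprK -!expr2 cos2Dsin2 cos0 sin0.
  by congr pair; ring.
have := @pi_gt0 R; move: hP hQ; rewrite (uE e Ee) (uF h Fh); lra.
Qed.

End Unicoherence.

(** * Dynamics along an ultrafilter *)

Section Ultrafilters.
Context {I : Type} {F : set_system I} {FU : UltraFilter F}.

Lemma ultraNP (P : set I) : ~ F P -> F (~` P).
Proof. by move=> nFP; have [|] := in_ultra_setVsetC P FU. Qed.

Lemma ultra_finite_const {Y : choiceType} (D : set Y) (f : I -> Y) :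
  finite_set D -> F [set i | D (f i)] -> exists2 d, D d & F [set i | f i = d].
Proof.
move=> /finite_seqP[s ->]; elim: s => [|d s IH].
  by move=> F0; have [] := filter_ex F0.
move=> Fds; have [Fd|nFd] := pselect (F [set i | f i = d]).
  by exists d => //=; rewrite inE eqxx.
have [|e se Fe] := IH.
  apply: filterS (filterI Fds (ultraNP nFd)) => i /= [+ fid].
  by rewrite inE => /orP[/eqP|].
by exists e => //=; rewrite inE /= in se *; rewrite se orbT.
Qed.

End Ultrafilters.

(** Each [J k] meets every tail, so indices can be chosen one after the other. This turns facts
    along the ultrafilter into facts about an actual subsequence. *)
Lemma ultra_subsequence (F : set_system nat) (FU : UltraFilter F)
    (cofin : forall N, F [set i | (N <= i)%N]) (J : nat -> set nat) :
  (forall k, F (J k)) ->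
  exists phi : nat -> nat, {homo phi : m n / (m < n)%N} /\ forall k, J k (phi k).
Proof.
move=> FJ.
have /choice[f fP] : forall kN : nat * nat, exists i, J kN.1 i /\ (kN.2 <= i)%N.
  by move=> [k N]; have [i [Ji Ni]] := filter_ex (filterI (FJ k) (cofin N)); exists i.
pose phi := fix phi k := if k is k'.+1 then f (k, (phi k').+1) else f (0, 0)%N.
exists phi; split; last first.
  by case=> [|k]; [have [] := fP (0, 0)%N|have [] := fP (k.+1, (phi k).+1)].
apply: homo_ltn; first exact: ltn_trans.
by move=> k; have [] := fP (k.+1, (phi k).+1).
Qed.

Lemma finite_bigcup_property {Y : choiceType} {T : Type} (P : set T -> Prop)
    (D : set Y) (f : Y -> set T) : finite_set D -> P set0 ->
  (forall A B, P A -> P B -> P (A `|` B)) -> (forall y, D y -> P (f y)) ->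
  P (\bigcup_(y in D) f y).
Proof.
move=> /finite_seqP[s ->] P0 PU; rewrite bigcup_seq => Pf.
by rewrite big_seq; elim/big_ind : _ => // y ys; exact: Pf.
Qed.

Section Dynamics.
Context {R : realType} {X : metricType R} {G : groupType}.
Variables (act : G -> X -> X) (g : nat -> G) (F : set_system nat).
Hypothesis FU : UltraFilter F.
Hypothesis cofin : forall N, F [set i | (N <= i)%N].
Hypothesis ginj : injective g.
Hypothesis actP : action_by_homeos act.
Hypothesis cX : compact [set: X].
Implicit Types (A B C K Q S T U V W Z : set X) (p q x y w : X).

Lemma act_continuous h : continuous (act h).
Proof. by have [] := actP. Qed.

Lemma actVK h x : act h^-1%g (act h x) = x.
Proof. by have [_ a1 aM] := actP; rewrite -aM mulVg a1. Qed.

Lemma actKV h x : act h (act h^-1%g x) = x.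
Proof. by have [_ a1 aM] := actP; rewrite -aM mulgV a1. Qed.

Lemma act_connected h S : connected S -> connected (act h @` S).
Proof.
move=> cS; apply: connected_continuous_connected => //.
exact/continuous_subspaceT/act_continuous.
Qed.

Lemma closed_compact_in S : closed S -> compact S.
Proof. by move=> clS; apply: subclosed_compact clS cX _. Qed.

Lemma compact_closed_in S : compact S -> closed S.
Proof. by apply: compact_closed; exact: metric_hausdorff. Qed.

Lemma nbhs_ball_sub x U : nbhs x U -> exists2 e : R, 0 < e & ball x e `<=` U.
Proof. by move=> /nbhs_ballP[e e0 eU]; exists e. Qed.

(** * Collapsing sets and singular points *)

Definition collapses S p :=
  forall U, nbhs p U -> F [set i | act (g i) @` S `<=` U].

Definition singular x := ~ exists U p, nbhs x U /\ collapses U p.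

Lemma collapsesS S T p : S `<=` T -> collapses T p -> collapses S p.
Proof.
move=> ST cT U nU; apply: filterS (cT U nU) => i; apply: subset_trans.
exact: image_subset.
Qed.

Lemma collapsesU S T p : collapses S p -> collapses T p -> collapses (S `|` T) p.
Proof.
move=> cS cT U nU; apply: filterS (filterI (cS U nU) (cT U nU)) => i /= [h1 h2].
by rewrite image_setU subUset.
Qed.

Lemma collapses0 p : collapses set0 p.
Proof. by move=> U _; apply: filterS filterT => i _ /=; rewrite image_set0. Qed.

Lemma ultra_limit (f : nat -> X) : exists t : X, forall U, nbhs t U -> F [set i | U (f i)].
Proof.
have FfU : UltraFilter (fmap f F).
  split; first exact: fmap_proper_filter.
  move=> H PH FH; apply/seteqP; split=> // S HS.
  apply: contrapT => nFS.
  have HnS : H (~` S) by apply: FH; exact: (@ultraNP _ F FU (f @^-1` S) nFS).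
  by have [x [Sx nSx]] := filter_ex (filterI HS HnS); exact: nSx Sx.
move: cX; rewrite compact_ultra => /(_ (fmap f F) FfU filterT)[t [_ ft]].
by exists t.
Qed.

Lemma collapses_point x : exists p, collapses [set x] p.
Proof.
have [p pP] := ultra_limit (fun i => act (g i) x).
exists p => U /pP; apply: filterS => i /= Ui.
by rewrite image_set1 => _ ->.
Qed.

Lemma collapses_unique S p q : S !=set0 -> collapses S p -> collapses S q -> p = q.
Proof.
move=> [x Sx] cp cq; apply: contrapT => pq.
have [V [oV Vp VU]] := nbhs_closed_sub (nbhs_neq pq).
have nq : nbhs q (~` closure V).
  apply: open_nbhs_nbhs; split; first exact/closed_openC/closed_closure.
  by move=> /VU; exact.
have [i [h1 h2]] := filter_ex (filterI (cp V (open_nbhs_nbhs (conj oV Vp))) (cq _ nq)).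
have Six : (act (g i) @` S) (act (g i) x) by exists x.
by apply: (h2 _ Six); apply: subset_closure; exact: h1.
Qed.

(** A weakening of collapsing to [p] that is stable under finite unions of pieces with different
    limits: what does not go to [p] stays away from it. *)
Definition splits S p := exists S1 S2 U, [/\ S `<=` S1 `|` S2, collapses S1 p,
  nbhs p U & F [set i | act (g i) @` S2 `&` U = set0]].

Lemma splits0 p : splits set0 p.
Proof.
exists set0, set0, setT; split => //; first exact: collapses0.
  exact: filterT.
by apply: filterS filterT => i _ /=; rewrite image_set0 set0I.
Qed.

Lemma splitsU S T p : splits S p -> splits T p -> splits (S `|` T) p.
Proof.
move=> [S1 [S2 [U [SS c1 nU h1]]]] [T1 [T2 [V [TT c2 nV h2]]]].
exists (S1 `|` T1), (S2 `|` T2), (U `&` V); split.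
- by rewrite setUACA; exact: setUSS.
- exact: collapsesU.
- exact: filterI.
- apply: filterS (filterI h1 h2) => i /= [e1 e2].
  rewrite -subset0 => y [[z [Sz|Tz] <-] [Uy Vy]].
    by rewrite -e1; split => //; exists z.
  by rewrite -e2; split => //; exists z.
Qed.

Lemma collapses_splits S p q : collapses S q -> splits S p.
Proof.
move=> cS; have [pq|pq] := pselect (p = q).
  exists S, set0, setT; split; rewrite ?setU0 ?pq//; first exact: filterT.
  by apply: filterS filterT => i _ /=; rewrite image_set0 set0I.
have [V [oV Vp VU]] := nbhs_closed_sub (nbhs_neq pq).
exists set0, S, V; split; [by rewrite set0U|exact: collapses0| |].
  exact: open_nbhs_nbhs.
have nq : nbhs q (~` closure V).
  apply: open_nbhs_nbhs; split; first exact/closed_openC/closed_closure.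
  by move=> /VU; exact.
apply: filterS (cS _ nq) => i /= h; rewrite -subset0 => y [/h cVy Vy].
by apply: cVy; exact: subset_closure.
Qed.

(** The images of [T] lie in a small [V] around [p] or off [closure V], and those of [T0] lie in
    [V]; being connected, the images of [T] stay in [V]. *)
Lemma connected_collapse T0 T p : connected T -> T0 `<=` T -> T0 !=set0 ->
  collapses T0 p -> splits T p -> collapses T p.
Proof.
move=> cT T0T [z T0z] c0 [S1 [S2 [U [TS c1 nU h2]]]] W nW.
have [V [oV Vp VUW]] := nbhs_closed_sub (filterI nU nW).
have nV := open_nbhs_nbhs (conj oV Vp).
apply: filterS (filterI (c0 V nV) (filterI (c1 V nV) h2)) => i /= [e0 [e1 e2]].
suff TV : act (g i) @` T `<=` V by move=> y /TV /subset_closure /VUW[].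
apply: (@connected_sub_open _ _ (~` closure V)).
- exact: act_connected.
- by [].
- exact/closed_openC/closed_closure.
- move=> _ [y /TS[S1y|S2y] <-]; first by left; apply: e1; exists y.
  right => /VUW[Uy _].
  have : (act (g i) @` S2 `&` U) (act (g i) y) by split => //; exists y.
  by rewrite e2.
- by rewrite -subset0 => y [[_ Vy]]; apply; exact: subset_closure.
- exists (act (g i) z); split; first by exists z => //; exact: T0T.
  by apply: e0; exists z.
Qed.

Lemma connected_collapse2 S1 S2 T p q : connected T -> T `<=` S1 `|` S2 ->
  collapses S1 p -> collapses S2 q -> exists r, collapses T r.
Proof.
move=> cT TS c1 c2; have [T1|/nonemptyPn T1] := pselect (T `&` S1 !=set0).
  exists p; apply: (@connected_collapse (T `&` S1)) => //.
    by apply: collapsesS c1.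
  have -> : T = (T `&` S1) `|` (T `&` S2) by rewrite -setIUr; exact/esym/setIidPl.
  by apply: splitsU; apply: collapses_splits;
    [apply: collapsesS c1|apply: collapsesS c2] => x [].
exists q; apply: collapsesS c2 => x Tx; have [S1x|//] := TS x Tx.
by have : (T `&` S1) x by []; rewrite T1.
Qed.

(** By singularity, the components of [x] and [y] off [T] do not collapse to [q], so some image of
    each leaves a neighbourhood of [q]. A connected [Q] containing the complement of that
    neighbourhood, with closure avoiding [q], pulls back to a connected set that misses [T] and
    meets both components. *)
Lemma collapsing_separator T q x y : locally_connected_space (X := X) ->
  connected (~` [set q]) -> closed T -> collapses T q -> ~ T x -> ~ T y ->
  meets_between T [set y] x -> singular x -> singular y -> False.
Proof.
move=> lc cq clT cTq Tx Ty sep sx sy.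
have oT : open (~` T) by exact: closed_openC.
pose U z := connected_component (~` T) z.
have nU z : ~ T z -> nbhs z (U z).
  move=> Tz; apply: open_nbhs_nbhs; split; first exact: component_open.
  exact: connected_component_refl.
have large z : singular z -> ~ T z ->
    exists2 W, nbhs q W & F [set i | ~ (act (g i) @` U z `<=` W)].
  move=> sz Tz; apply: contrapT => nW; apply: sz; exists (U z), q.
  split; first exact: nU.
  move=> W nqW; apply: contrapT => nF; apply: nW; exists W => //.
  exact: ultraNP nF.
have [W1 nW1 F1] := large x sx Tx; have [W2 nW2 F2] := large y sy Ty.
have cK : compact (~` (W1 `&` W2)°).
  by apply: closed_compact_in; apply: open_closedC; exact: open_interior.
have [|Q [cQ KQ Qq]] := connected_hull lc cq cK.
  by apply; exact: filterI.
have nQ : nbhs q (~` closure Q).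
  by apply: open_nbhs_nbhs; split => //; exact/closed_openC/closed_closure.
have [i [/= h1 [h2 h3]]] := filter_ex (filterI F1 (filterI F2 (cTq _ nQ))).
pose Z := act (g i)^-1%g @` Q.
have cZ : connected Z by exact: act_connected.
have ZT : Z `<=` ~` T.
  move=> _ [z Qz <-] Tz.
  have /h3 : (act (g i) @` T) z by exists (act (g i)^-1%g z); rewrite ?actKV.
  by apply; exact: subset_closure.
have meetsZ z W : ~ (act (g i) @` U z `<=` W) -> W1 `&` W2 `<=` W ->
    exists2 v, U z v & Z v.
  move=> nUW WW; apply: contrapT => noZ; apply: nUW => _ [v Uv <-].
  apply: contrapT => Wv; apply: noZ; exists v => //.
  exists (act (g i) v); last by rewrite actVK.
  by apply: KQ => /interior_subset /WW.
have [u Uu Zu] := meetsZ x W1 h1 (@subIsetl _ _ _).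
have [v Uv Zv] := meetsZ y W2 h2 (@subIsetr _ _ _).
have xy : connected_component (~` T) x y.
  apply: connected_component_trans Uu _.
  apply: (@connected_component_trans _ _ v); first by exists Z.
  exact: connected_component_sym.
have [|||z [xz Tz]] := sep (connected_component (~` T) x).
- exact: component_connected.
- exact: connected_component_refl.
- by exists y.
- exact: (connected_component_sub xz).
Qed.

(** If no pair works along [F], each pair in [A * A] has a neighbourhood and an [F]-large index set
    on which no subsequence converges with a pair from that neighbourhood. By compactness one index
    set serves all pairs, and a subsequence within it contradicts [conv]. *)
Lemma convergence_along (H : set G) A (h : nat -> G) : closed A ->
  injective h -> F [set i | H (h i)] -> convergence_group_on act H A ->
  exists n p, [/\ A n, A p & forall C, C `<=` A -> closed C -> ~ C n ->
    forall U, nbhs p U -> F [set i | act (h i) @` C `<=` U]].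
Proof.
move=> clA hinj FH conv; apply: contrapT => no.
have cAA : compact (A `*` A).
  by apply: compact_setX; exact: closed_compact_in.
pose converges (psi : nat -> nat) (z : X * X) := forall C, C `<=` A -> compact C ->
  ~ C z.1 -> forall U, nbhs z.2 U -> \forall i \near \oo, act (h (psi i)) @` C `<=` U.
have [J FJ JP] : exists2 J, F J & forall psi, (forall i, J (psi i)) ->
    forall z, (A `*` A) z -> ~ converges psi z.
  have := compact_local_property cAA (P := fun S : set (X * X) =>
    exists2 J, F J & forall psi, (forall i, J (psi i)) ->
    forall z, S z -> ~ converges psi z); apply.
  - by exists setT => //; exact: filterT.
  - by move=> S T ST [J FJ JP]; exists J => // psi psiJ z /ST; exact: JP.
  - move=> S T [J FJ JP] [J' FJ' JP']; exists (J `&` J'); first exact: filterI.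
    move=> psi psiJ z [Sz|Tz].
      by apply: JP => // i; have [] := psiJ i.
    by apply: JP' => // i; have [] := psiJ i.
  - move=> [n p] [/= An Ap].
    have [C [U [CA clC Cn nU nF]]] : exists C U,
        [/\ C `<=` A, closed C, ~ C n, nbhs p U &
           ~ F [set i | act (h i) @` C `<=` U]].
      apply: contrapT => no'; apply: no; exists n, p; split => // C CA clC Cn U nU.
      by apply: contrapT => nF; apply: no'; exists C, U.
    (* A repeller outside [C] and an attractor inside [U] would eventually force the images of [C]
       into [U]. *)
    exists (~` C `*` U°).
      exists (~` C, U°) => //=; split; last exact: nbhs_interior.
      by apply: open_nbhs_nbhs; split => //; exact: closed_openC.
    exists (~` [set i | act (h i) @` C `<=` U]); first exact: ultraNP.
    move=> psi psiJ [n' p'] [/= Cn' Up'] /(_ C CA (closed_compact_in clC) Cn').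
    by move=> /(_ U Up') [N _ /(_ N (leqnn N))]; exact: psiJ.
have [psi [psimono psiJ]] := ultra_subsequence FU cofin (fun=> filterI FH FJ).
have psiinj : injective psi.
  move=> a b ab; have [lt|lt|//] := ltngtP a b.
    by have := psimono a b lt; rewrite ab ltnn.
  by have := psimono b a lt; rewrite ab ltnn.
have [||phi [phimono [n [p [An Ap np]]]]] := conv (h \o psi).
- by move=> a b /hinj /psiinj.
- by move=> i; have [] := psiJ i.
- apply: (JP (psi \o phi) _ (n, p)) => //.
  by move=> i; have [] := psiJ (phi i).
Qed.

(** * Dynamics of the members of [cA] *)

Variable cA : set (set X).
Hypothesis lc : locally_connected_space (X := X).
Hypothesis connX : connected [set: X].
Hypothesis unicohX : unicoherent (X := X).
Hypothesis neX : [set: X] !=set0.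
Hypothesis nocut : forall x : X, ~ cut_point x.
Hypothesis cAcc : forall A, cA A -> connected A /\ closed A.
Hypothesis cAinv : forall (h : G) A, cA A -> cA (act h @` A).
Hypothesis null : forall eps : R, 0 < eps ->
  finite_set [set A | cA A /\ eps < diam A].
Hypothesis fine : forall x y : X, x <> y ->
  exists B : set (set X), [/\ finite_set B, B `<=` cA &
    separates (\bigcup_(A in B) A) x y].
Hypothesis stab : forall A, cA A -> convergence_group_on act (stabilizer act A) A.

Lemma cA_closed A : cA A -> closed A.
Proof. by move=> /cAcc[]. Qed.

Lemma connected_compl1 x : connected (~` [set x]).
Proof. by apply: contrapT; exact: nocut. Qed.

(** Compactness of [X] bounds the distances, so the [sup] in [diam] is a genuine upper bound. *)
Lemma mdist_le_diam A x y : A x -> A y -> mdist x y <= diam A.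
Proof.
move=> Ax Ay; rewrite /diam.
have [M MP] : exists M, forall z, [set: X] z -> mdist x z <= M.
  apply: (compact_local_property cX (P := fun S => exists M,
      forall z, S z -> mdist x z <= M)).
  - by exists 0.
  - by move=> S T ST [M MP]; exists M => z /ST; exact: MP.
  - move=> S T [M MP] [N NP]; exists (Num.max M N) => z [/MP|/NP] h.
      by rewrite le_max h.
    by rewrite le_max h orbT.
  - move=> z _; exists (ball z 1); first exact: nbhsx_ballx.
    exists (mdist x z + 1) => v; rewrite ballEmdist /= => zv.
    by apply: (le_trans (metric_triangle x z v)); rewrite lerD2l ltW.
have ub : has_ubound [set mdist u v | u in A & v in A].
  exists (M + M) => _ [u Au [v Av <-]].
  apply: (le_trans (metric_triangle u x v)); rewrite (metric_sym u x).
  by apply: lerD; exact: MP.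
by apply: (ub_le_sup ub); exists x => //; exists y.
Qed.

Lemma small_collapses A a : A a -> (forall eps : R, 0 < eps ->
    F [set i | diam (act (g i) @` A) <= eps]) -> exists d, collapses A d.
Proof.
move=> Aa small; have [d da] := collapses_point a.
exists d => W /nbhs_ball_sub[e e0 eW].
have e30 : 0 < e / 3 by rewrite divr_gt0.
have := da (ball d (e / 3)) (nbhsx_ballx _ _ e30).
move=> /(filterI (small _ e30)); apply: filterS => i /= [di ai] _ [z Az <-].
have dai : mdist d (act (g i) a) < e / 3.
  by have := ai (act (g i) a) (ex_intro2 _ _ a erefl erefl); rewrite ballEmdist.
apply: eW; rewrite ballEmdist /=.
apply: (le_lt_trans (metric_triangle d (act (g i) a) _)).
have : mdist (act (g i) a) (act (g i) z) <= e / 3.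
  by apply: le_trans di; apply: mdist_le_diam; [exists a|exists z].
by move: dai e0; lra.
Qed.

(* The data of an [A] in [cA] whose translates do not shrink to a point: they
   are eventually a fixed set [A'], with repeller [n] and attractor [p]. *)
Definition steady A A' n p := [/\ cA A /\ ~ (exists d, collapses A d),
  F [set i | act (g i) @` A = A'], A n, A' p &
  forall C, C `<=` A -> closed C -> ~ C n -> collapses C p].

(** Without collapse, the diameters of the images stay above some [eps] along [F]; nullness leaves
    finitely many candidates, and the ultrafilter selects one, [A']. Multiplying by the inverse of
    one [g i0] lands in the stabilizer of [A], where (iii) applies. *)
Lemma collapses_or_steady A : cA A ->
  (exists d, collapses A d) \/ exists A' n p, steady A A' n p.
Proof.
move=> cAA; have [?|nA] := pselect (exists d, collapses A d); [by left|right].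
have [cnA clA] := cAcc cAA.
have [[a Aa]|/nonemptyPn A0] := pselect (A !=set0); last first.
  case: nA; have [x _] := neX.
  by exists x; rewrite A0; exact: collapses0.
have [eps eps0 Feps] : exists2 eps : R, 0 < eps &
    F [set i | eps < diam (act (g i) @` A)].
  apply: contrapT => no; apply: nA; apply: small_collapses Aa _ => eps eps0.
  apply: contrapT => nF; apply: no; exists eps => //.
  by apply: filterS (ultraNP nF) => i /= /negP; rewrite -ltNge.
have [|A' _ FA'] := ultra_finite_const (f := fun i => act (g i) @` A) (null eps0).
  by apply: filterS Feps => i /= ?; split=> //; exact: cAinv.
have [i0 i0A] := filter_ex FA'; rewrite /= in i0A.
pose h i := ((g i0)^-1 * g i)%g.
have hE i x : act (h i) x = act (g i0)^-1%g (act (g i) x) by have [_ _ ->] := actP.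
have [||n [p [An Ap np]]] := convergence_along clA (h := h) _ _ (stab cAA).
- by move=> i j /mulgI /ginj.
- apply: filterS FA' => i /= iA.
  apply/seteqP; split=> [_ [x Ax <-]|x Ax].
    have : A' (act (g i) x) by rewrite -iA; exists x.
    by rewrite -i0A => -[y Ay yx]; rewrite hE -yx actVK.
  have : A' (act (g i0) x) by rewrite -i0A; exists x.
  by rewrite -iA => -[y Ay yx]; exists y => //; rewrite hE yx actVK.
exists A', n, (act (g i0) p); split => //; first by rewrite -i0A; exists p.
move=> C CA clC Cn U nU.
have := np C CA clC Cn _ (act_continuous nU).
by apply: filterS => i /= hC _ [x Cx <-]; have := hC (act (h i) x);
  rewrite /= hE actKV; apply; exists x.
Qed.

Lemma steady_image_closed A A' n p : steady A A' n p -> closed A'.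
Proof.
move=> [[cAA _] /filter_ex[i <-] _ _ _].
by apply: cA_closed; exact: cAinv.
Qed.

Lemma steady_punctured_collapse A A' n p V : steady A A' n p -> open V -> V n ->
  collapses (A `\` V) p.
Proof.
move=> [[cAA _] _ _ _ np] oV Vn; apply: np; first by move=> x [].
  by apply: closedI; [exact: cA_closed|exact: open_closedC].
by move=> [].
Qed.

(** If a neighbourhood of [n] collapsed, it and the rest of [A] would make the connected set [A]
    collapse. *)
Lemma steady_repeller_singular A A' n p : steady A A' n p -> singular n.
Proof.
move=> st [U [d [nU cU]]]; have [[cAA nA] _ _ _ _] := st; apply: nA.
move: (nU); rewrite nbhsE => -[V [oV Vn] VU].
apply: (connected_collapse2 _ _ (steady_punctured_collapse st oV Vn) cU).
  by have [] := cAcc cAA.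
by move=> x Ax; have [Vx|Vx] := pselect (V x); [right; exact: VU|left].
Qed.

(** With distinct repellers, [A] would be covered by two collapsing sets, each omitting a
    neighbourhood of one repeller. *)
Lemma steady_repeller_unique A A' A'' n n' p p' :
  steady A A' n p -> steady A A'' n' p' -> n = n'.
Proof.
move=> st st'; apply: contrapT => nn'; have [[cAA nA] _ _ _ _] := st; apply: nA.
have [V [oV Vn VU]] := nbhs_closed_sub (nbhs_neq nn').
have oV' : open (~` closure V) by exact/closed_openC/closed_closure.
have Vn' : (~` closure V) n' by move=> /VU; exact.
apply: (connected_collapse2 _ _ (steady_punctured_collapse st oV Vn)
  (steady_punctured_collapse st' oV' Vn')).
  by have [] := cAcc cAA.
move=> x Ax; have [Vx|Vx] := pselect (V x); last by left.
by right; split=> //; apply; exact: subset_closure.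
Qed.

(** * Location of repellers and uniqueness of the singular point *)

Definition backward_limit p (t : X) := forall U, nbhs t U -> F [set i | U (act (g i)^-1%g p)].

Lemma backward_limit_exists p : exists t, backward_limit p t.
Proof. exact: ultra_limit. Qed.

Lemma backward_limit_mem p t C C' m q : backward_limit p t -> steady C C' m q ->
  C' p -> C t.
Proof.
move=> pt [[cC _] FC _ _ _] C'p; apply: contrapT => Ct.
have nt : nbhs t (~` C).
  by apply: open_nbhs_nbhs; split => //; apply: closed_openC; exact: cA_closed.
have [i [/= iC]] := filter_ex (filterI FC (pt _ nt)).
by apply; move: C'p; rewrite -iC => -[x Cx <-]; rewrite actVK.
Qed.

(* The sets [C] with [C' p] all contain [t], so by nullness only finitely many
   of them have a repeller far from [t]. *)
Lemma repellers_discrete p t w : backward_limit p t -> w <> t ->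
  exists2 O, nbhs w O & forall C C' m q, steady C C' m q -> C' p -> O m -> m = w.
Proof.
move=> pt wt; have d0 : 0 < mdist w t by rewrite mdist_gt0; exact/eqP.
have d20 : 0 < mdist w t / 2 by rewrite divr_gt0.
(* A repeller within half the distance from [w] to [t] is farther than that half from [t], which
   lies in the same [C]; so [C] is one of the finitely many members of [D]. *)
pose D := [set A | cA A /\ mdist w t / 2 < diam A].
pose N := \bigcup_(C in D) [set m | (exists C' q, steady C C' m q) /\ m <> w].
have clN : closed N.
  apply: (accessible_finite_set_closed.1 _ _).
    by apply: hausdorff_accessible; exact: metric_hausdorff.
  apply: bigcup_finite; first exact: null.
  move=> C _; have [[m0 [C0 [q0 st0]]]|no] := pselect (exists m C' q, steady C C' m q).
    apply: (@sub_finite_set _ _ [set m0]); last exact: finite_set1.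
    by move=> m [[C' [q st]] _] /=; exact: steady_repeller_unique st st0.
  apply: (@sub_finite_set _ _ set0); last exact: finite_set0.
  by move=> m [[C' [q st]] _] /=; apply: no; exists m, C', q.
exists (ball w (mdist w t / 2) `&` ~` N).
  apply: filterI; first exact: nbhsx_ballx.
  apply: open_nbhs_nbhs; split; first exact: closed_openC.
  by move=> [C _ [_]]; exact.
move=> C C' m q st C'p [wm Nm]; apply: contrapT => mw.
apply: Nm; exists C; last by split => //; exists C', q.
have [[cC _] _ Cm _ _] := st; split => //.
have Ct := backward_limit_mem pt st C'p.
apply: (lt_le_trans _ (mdist_le_diam Cm Ct)).
have := metric_triangle w m t.
by move: wm; rewrite ballEmdist /=; lra.
Qed.

(* A small separator around [w] meets [A] away from [n] and contains no
   repeller of a set [C] with [C' p], so it collapses to [p] altogether. *)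
Lemma no_two_singular_near A A' n p w w' O : steady A A' n p -> A w ->
  singular w -> singular w' -> w <> w' -> nbhs w O ->
  (forall C C' m q, steady C C' m q -> C' p -> O m -> m = w) -> False.
Proof.
move=> st Aw sw sw' ww' nO repO; have [[cAA nA] FA An A'p np] := st.
have [cnA clA] := cAcc cAA.
have [c Ac cw] : exists2 c, A c & c <> w.
  apply: contrapT => no; apply: nA; have [d wd] := collapses_point w.
  exists d; apply: collapsesS wd => x Ax; apply: contrapT => xw.
  by apply: no; exists x.
have cK : compact [set w'; c] by apply: compactU; exact: compact_set1.
(* Putting both [w'] and [c] in [Q] makes [T] separate the two singular points and also meet [A],
   which joins [w] to [c]. *)
have [|Q [cQ KQ Qw]] := connected_hull lc (@connected_compl1 w) cK.
  by move=> [e|e]; [exact: ww'|exact: cw].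
have [Qw' Qc] : Q w' /\ Q c by split; apply: KQ; [left|right].
pose L := closure Q `|` ~` O°.
have cL : compact L.
  apply: closed_compact_in; apply: closedU; first exact: closed_closure.
  by apply: open_closedC; exact: open_interior.
have [|B [fB BA Bw U0]] := @neighbourhood_basis _ _ lc cA w L cA_closed fine cL.
  by move=> [//|]; apply.
set U := connected_component _ _ in U0.
have UO m : closure U m -> O m.
  move=> Um; apply: contrapT => Om; have : (closure U `&` L) m.
    by split=> //; right; apply: contra_not Om; exact: interior_subset.
  by rewrite U0.
have clS : closed (\bigcup_(A in B) A) by apply: closed_bigcup => // C /BA /cA_closed.
have [||T [[clT cT] TS TU [Tw TQ] sep]] := boundary_separator lc connX unicohX clS Bw cQ.
- by exists c.
- rewrite -subset0 => m [Um Qm]; rewrite -U0; split => //.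
  by left; exact: subset_closure.
have Trep C C' m q : steady C C' m q -> C' p -> ~ T m.
  by move=> stC C'p Tm; apply: Tw; rewrite -(repO _ _ _ _ stC C'p (UO _ (TU _ Tm))).
have collT : collapses T p.
  apply: (@connected_collapse (T `&` A)) => //.
  - by have [|z [Az Tz]] := sep A cnA Aw; [exists c|exists z].
  - apply: np; [by move=> z []|exact: closedI|].
    by move=> [Tn _]; exact: Trep st A'p Tn.
  - have -> : T = \bigcup_(C in B) (T `&` C).
      by rewrite -setI_bigcupr; exact/esym/setIidPl.
    apply: (finite_bigcup_property fB (P := fun S => splits S p)).
    + exact: splits0.
    + by move=> S1 S2; exact: splitsU.
    move=> C /BA cAC; have [[d Cd]|[C' [m [q stC]]]] := collapses_or_steady cAC.
      apply: collapses_splits; apply: (collapsesS _ Cd); exact: subIsetr.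
    have [[_ _] FC _ _ mq] := stC; have [_ clC] := cAcc cAC.
    (* If [T] contains the repeller [m], then [C'] cannot contain [p], and the images of [C] equal
       the closed set [C'], away from [p]. *)
    have [Tm|Tm] := pselect (T m); last first.
      apply: (@collapses_splits _ p q); apply: mq; [exact: subIsetr|exact: closedI|].
      by move=> [].
    exists set0, (T `&` C), (~` C'); split.
    + by rewrite set0U.
    + exact: collapses0.
    + apply: open_nbhs_nbhs; split; first exact/closed_openC/(steady_image_closed stC).
      by move=> C'p; exact: Trep stC C'p Tm.
    + apply: filterS FC => i /= iC; rewrite -subset0 => y [[z [_ Cz] <-]]; apply.
      by rewrite -iC; exists z.
apply: (collapsing_separator lc (@connected_compl1 p) clT collT Tw _ _ sw sw').
  by move=> Tw'; have : (T `&` Q) w' by []; rewrite TQ.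
by move=> Z cZ Zw [z [Zz zw']]; apply: sep => //; exists z; split=> //; rewrite (zw' : z = w').
Qed.

(** Both [n] and [z] lie in [A], and at least one differs from [t]; the separator is taken around
    that one. *)
Lemma steady_singular_mem A A' n p z : steady A A' n p -> A z -> singular z -> z = n.
Proof.
move=> st Az sz; apply: contrapT => zn; have [_ _ An _ _] := st.
have sn := steady_repeller_singular st.
have [t pt] := backward_limit_exists p.
have [tn|tn] := pselect (n = t).
  have [|O nO repO] := @repellers_discrete p t z pt; first by rewrite -tn.
  exact: no_two_singular_near st Az sz sn zn nO repO.
have [O nO repO] := repellers_discrete pt tn.
by apply: no_two_singular_near st An sn sz _ nO repO => /esym.
Qed.

(** Here [z] may lie outside [A], so the separator must surround [n]. If [t = n], every [C] with [p]
    in [C'] contains the singular point [n], which is then its repeller, and no restriction on the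
    neighbourhood is required. *)
Lemma steady_singular_unique A A' n p z : steady A A' n p -> singular z -> z = n.
Proof.
move=> st sz; apply: contrapT => zn; have [_ _ An _ _] := st.
have sn := steady_repeller_singular st.
have nz : n <> z by move=> /esym.
have [t pt] := backward_limit_exists p.
have [tn|tn] := pselect (n = t); last first.
  have [O nO repO] := repellers_discrete pt tn.
  exact: no_two_singular_near st An sn sz nz nO repO.
apply: (no_two_singular_near st An sn sz nz (O := setT)); first exact: filterT.
move=> C C' m q stC C'p _; apply/esym.
apply: (steady_singular_mem stC _ sn).
by rewrite tn; exact: backward_limit_mem pt stC C'p.
Qed.

Lemma singular_unique x y : singular x -> singular y -> x = y.
Proof.
move=> sx sy; apply: contrapT => xy.
have [[A [A' [n [p st]]]]|nosteady] := pselect (exists A A' n p, steady A A' n p).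
  by apply: xy; rewrite (steady_singular_unique st sx) (steady_singular_unique st sy).
have coll A : cA A -> exists d, collapses A d.
  move=> /collapses_or_steady[//|[A' [n [p st]]]].
  by case: nosteady; exists A, A', n, p.
have [|B [fB BA Bx U0]] := @neighbourhood_basis _ _ lc cA x [set y]
  cA_closed fine (@compact_set1 X y); first exact: xy.
have clS : closed (\bigcup_(A in B) A) by apply: closed_bigcup => // C /BA /cA_closed.
have [|T [[clT cT] TS TU [Tx Ty] sep]] := boundary_separator lc connX unicohX clS Bx
  (@connected1 X y) _ U0; first by exists y.
(* [X] itself joins [x] to [y], so [T] is nonempty and some [C0] provides the limit [d] to which all
   of [T] must collapse. *)
have [|z [_ Tz]] := sep [set: X] connX I; first by exists y.
have [C0 BC0 C0z] := TS z Tz; have [d C0d] := coll C0 (BA _ BC0).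
have collT : collapses T d.
  apply: (@connected_collapse (T `&` C0)) => //.
  - by exists z.
  - by apply: collapsesS C0d => u [].
  have -> : T = \bigcup_(C in B) (T `&` C).
    by rewrite -setI_bigcupr; exact/esym/setIidPl.
  apply: (finite_bigcup_property fB (P := fun S => splits S d)).
  - exact: splits0.
  - by move=> S1 S2; exact: splitsU.
  - move=> C /BA /coll[e Ce]; apply: collapses_splits.
    by apply: (collapsesS _ Ce) => u [].
apply: (collapsing_separator lc (@connected_compl1 d) clT collT Tx _ sep sx sy).
by move=> Ty'; have : (T `&` [set y]) y by []; rewrite Ty.
Qed.

(** * The attractor and the convergent subsequence *)

Lemma attractor_exists : exists n p,
  forall K, compact K -> ~ K n -> collapses K p.
Proof.
have [n regular] : exists n, forall x, x <> n -> exists U p, nbhs x U /\ collapses U p.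
  have [[n sn]|no] := pselect (exists n, singular n).
    exists n => x xn; apply: contrapT => sx; apply: xn; exact: singular_unique.
  have [n _] := neX; exists n => x _; apply: contrapT => sx; apply: no; by exists x.
(* If [n] is the only point of [X], then [K] is empty and any [p] serves; otherwise [p] is the limit
   at some [a]. *)
exists n; have [[a an]|noa] := pselect (exists a, a <> n); last first.
  exists n => K _ Kn; suff -> : K = set0 by exact: collapses0.
  rewrite -subset0 => x Kx; apply: noa; exists x => xn; by rewrite xn in Kx.
have [Ua [p [nUa cUa]]] := regular a an; exists p => K cK Kn.
pose good y := exists U, nbhs y U /\ collapses U p.
have oG : open [set y | good y].
  rewrite openE => y [U [nU cU]]; rewrite /interior /=.
  by apply: filterS (nbhs_interior nU) => z nz; exists U.
have oB : open [set y | y <> n /\ ~ good y].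
  rewrite openE => y [yn gy]; have [U [q [nU cU]]] := regular y yn.
  have qp : q <> p by move=> qp; apply: gy; exists U; rewrite -qp.
  apply: filterS (filterI (nbhs_neq yn) (nbhs_interior nU)) => z [zn nz].
  split=> // -[V [nV cV]]; apply: qp.
  apply: (@collapses_unique [set z]); first by exists z.
    by apply: collapsesS cU => _ ->; exact: nbhs_singleton nz.
  by apply: collapsesS cV => _ ->; exact: nbhs_singleton nV.
have allgood : ~` [set n] `<=` [set y | good y].
  apply: (connected_sub_open (@connected_compl1 n) oG oB).
  - by move=> y yn; have [|] := pselect (good y); [left|right].
  - by rewrite -subset0 => y [[_ gy] []].
  - by exists a; split=> //; exists Ua.
apply: (compact_local_property cK (P := fun S => collapses S p)).
- exact: collapses0.
- by move=> S T ST; exact: collapsesS.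
- by move=> S T; exact: collapsesU.
- move=> x Kx; have [|U [nU cU]] := allgood x; last by exists U.
  by move=> xn; rewrite xn in Kx.
Qed.

Lemma convergence_subsequence : exists phi : nat -> nat,
  {homo phi : m n / (m < n)%N} /\
  convergence_sequence_on act [set: X] (g \o phi).
Proof.
have [n [p np]] := attractor_exists.
pose r (k : nat) : R := k.+1%:R^-1.
have r0 k : 0 < r k by rewrite invr_gt0 ltr0n.
(* Diagonal choice: the k-th index sends everything off the ball of radius [r k] at [n] into the
   ball of radius [r k] at [p]. *)
have FJ k : F [set i | act (g i) @` (~` (ball n (r k))°) `<=` ball p (r k)].
  apply: np; last exact: nbhsx_ballx.
  - by apply: closed_compact_in; apply: open_closedC; exact: open_interior.
  - by apply; apply: nbhsx_ballx.
have [phi [phimono phiJ]] := ultra_subsequence FU cofin FJ.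
exists phi; split => //; exists n, p; split => // C _ cC Cn U nU.
have nC : nbhs n (~` C).
  apply: open_nbhs_nbhs; split => //; apply: closed_openC.
  exact: compact_closed_in.
have [e1 e10 e1C] := nbhs_ball_sub nC; have [e2 e20 e2U] := nbhs_ball_sub nU.
have h1 := near_infty_natSinv_lt (PosNum e10).
have h2 := near_infty_natSinv_lt (PosNum e20).
apply: filterS (filterI h1 h2) => k [/= k1 k2] _ [x Cx <-].
apply: e2U; apply: (le_ball (ltW k2)); apply: (phiJ k); exists x => //.
move=> /interior_subset /(le_ball (ltW k1)) /e1C; exact.
Qed.

End Dynamics.

Unset Implicit Arguments.

Theorem mainTheorem1 (R : realType) (X : metricType R) (G : groupType)
    (act : G -> X -> X) (cA : set (set X)) :
  peano_continuum (X := X) ->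
  (forall x : X, ~ cut_point x) ->
  ~ (exists f : X -> R * R, essential_circle_map f) ->
  action_by_homeos act ->
  (forall A, cA A -> connected A /\ closed A) ->
  (forall (g : G) A, cA A -> cA (act g @` A)) ->
  (* (i) null *)
  (forall eps : R, 0 < eps -> finite_set [set A | cA A /\ eps < diam A]) ->
  (* (ii) fine *)
  (forall x y : X, x <> y ->
     exists B : set (set X), [/\ finite_set B, B `<=` cA &
       separates (\bigcup_(A in B) A) x y]) ->
  (* (iii) stabilizers act as convergence groups *)
  (forall A, cA A -> convergence_group_on act (stabilizer act A) A) ->
  convergence_group_on act [set: G] [set: X].
Proof.
move=> [cX connX lc neX] nocut noess actP cAcc cAinv null fine stab g ginj _.
have [F [FU oF]] := @ultraFilterLemma nat \oo _.
have cofin N : F [set i | (N <= i)%N] by apply: oF; exact: nbhs_infty_ge.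
have unicohX := no_essential_map_unicoherent cX noess.
exact: (@convergence_subsequence R X G act g F FU cofin ginj actP cX cA).
Qed.
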